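(* Let $d\ge2$ and let $T',T''\in\mathbb{R}^{n_1\times\cdots\times n_d}$ be tensors having TR-representations with cores $G_k'\in\mathbb{R}^{r_{k-1}'\times n_k\times r_k'}$ and $G_k''\in\mathbb{R}^{r_{k-1}''\times n_k\times r_k''}$, respectively, for $k=1,\ldots,d$ (with $r_d'=r_0'$, $r_d''=r_0''$). Then the tensor $T=T'+T''$ can be written in TR-format with cores $G_k$, i.e. $T(i_1,\ldots,i_d)=\operatorname{Trace}(G_1(i_1)\cdots G_d(i_d))$ for all indices, where $$G_k(i_k)=\begin{bmatrix}G_k'(i_k)&0\\0&G_k''(i_k)\end{bmatrix},\qquad k=2,\ldots,d-1,$$ and the end cores are as follows. If $r_0'\ge r_0''$: $$G_1(i_1)=\left[\,G_1'(i_1)\ \Big|\ \begin{bmatrix}G_1''(i_1)\\0_{(r_0'-r_0'')\times r_1''}\end{bmatrix}\right],\qquad G_d(i_d)=\begin{bmatrix}G_d'(i_d)\\ \big[\,G_d''(i_d)\ \big|\ 0_{r_{d-1}''\times(r_0'-r_0'')}\big]\end{bmatrix}.$$ If $r_0'\le r_0''$: $$G_1(i_1)=\left[\,\begin{bmatrix}G_1'(i_1)\\0_{(r_0''-r_0')\times r_1'}\end{bmatrix}\ \Big|\ G_1''(i_1)\right],\qquad G_d(i_d)=\begin{bmatrix}\big[\,G_d'(i_d)\ \big|\ 0_{r_{d-1}'\times(r_0''-r_0')}\big]\\ G_d''(i_d)\end{bmatrix}.$$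
   Context: TR-format: a tensor $T\in\mathbb{R}^{n_1\times\cdots\times n_d}$ has a TR-representation with cores $G_k\in\mathbb{R}^{r_{k-1}\times n_k\times r_k}$, $k=1,\ldots,d$, $r_d=r_0$, if $T(i_1,\ldots,i_d)=\operatorname{Trace}(G_1(i_1)\cdots G_d(i_d))$ for all indices, where $G_k(i_k)\in\mathbb{R}^{r_{k-1}\times r_k}$ denotes the matrix slice $G_k(\cdot,i_k,\cdot)$. Here $0_{p\times q}$ is the zero matrix of size $p\times q$ (possibly empty), a vertical bar denotes horizontal concatenation, and stacking denotes vertical concatenation. *)

(* Defs.v *)
From HB Require Import structures.
From mathcomp Require Import all_boot all_order all_algebra.
From mathcomp Require Import reals.

Set Implicit Arguments.
Unset Strict Implicit.
Unset Printing Implicit Defensive.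

Import Order.TTheory GRing.Theory Num.Theory.
Local Open Scope ring_scope.

(* All indices are 0-based: mode k : 'I_d is the k.+1-st mode. *)
Definition multi_index (d : nat) (n : 'I_d -> nat) :=
  {dffun forall k : 'I_d, 'I_(n k)}.

Definition tensor (R : realType) (d : nat) (n : 'I_d -> nat) :=
  {ffun multi_index n -> R}.

(* An order-3 array of size p x n x q, given by its n matrix slices
   G(., i, .). *)
Definition core (R : realType) (p n q : nat) := 'I_n -> 'M[R]_(p, q).

(* A rank sequence r_0, ..., r_d is a function nat -> nat whose values
   beyond d are irrelevant. *)
Definition cores (R : realType) (d : nat) (n : 'I_d -> nat) (r : nat -> nat) :=
  forall k : 'I_d, core R (r k) (n k) (r k.+1).

(* The product of the first m factors A_0 *m ... *m A_(m-1). *)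
Fixpoint chain_mx (R : realType) (d : nat) (r : nat -> nat)
    (A : forall k : 'I_d, 'M[R]_(r k, r k.+1)) (m : nat) :
    (m <= d)%N -> 'M[R]_(r 0%N, r m) :=
  match m return (m <= d)%N -> 'M[R]_(r 0%N, r m) with
  | 0 => fun _ => 1%:M
  | m'.+1 => fun lt_m'd => chain_mx A (ltnW lt_m'd) *m A (Ordinal lt_m'd)
  end.

Definition TR_representation (R : realType) (d : nat) (n : 'I_d -> nat)
    (r : nat -> nat) (r_closed : r d = r 0%N) (G : cores R n r)
    (T : tensor R n) : Prop :=
  forall i : multi_index n,
    T i = \tr (castmx (erefl (r 0%N), r_closed)
                 (chain_mx (fun k => G k (i k)) (leqnn d))).

(* Equality of cores whose sizes are equal only propositionally; the equality
   of the sizes is part of the assertion, even when n = 0. *)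
Definition core_eq (R : realType) (p p' n q q' : nat)
    (G : core R p n q) (H : core R p' n q') : Prop :=
  exists e : (p = p') * (q = q'), forall i : 'I_n, castmx e (G i) = H i.

Definition pad_rows (R : realType) (m p q : nat) (le_mp : (m <= p)%N)
    (A : 'M[R]_(m, q)) : 'M[R]_(p, q) :=
  castmx (subnKC le_mp, erefl q) (col_mx A (0 : 'M[R]_(p - m, q))).

Definition pad_cols (R : realType) (m p q : nat) (le_mp : (m <= p)%N)
    (A : 'M[R]_(q, m)) : 'M[R]_(q, p) :=
  castmx (erefl q, subnKC le_mp) (row_mx A (0 : 'M[R]_(q, p - m))).

Lemma first_rank_le (r s : nat -> nat) (k : nat) :
  (r 0 <= s 0)%N -> k = 0%N -> (r k <= s k)%N.
Proof. by move=> le_rs ->. Qed.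

Lemma last_rank_le (r s : nat -> nat) (d k : nat) :
  r d = r 0%N -> s d = s 0%N -> (r 0 <= s 0)%N -> k.+1 = d ->
  (r k.+1 <= s k.+1)%N.
Proof. by move=> er es le_rs ->; rewrite er es. Qed.

(* Main.v *)
Require Import Defs.
From HB Require Import structures.
From mathcomp Require Import all_boot all_order all_algebra.
From mathcomp Require Import reals.

Set Implicit Arguments.
Unset Strict Implicit.
Unset Printing Implicit Defensive.

Import Order.TTheory GRing.Theory Num.Theory.
Local Open Scope ring_scope.

(** Each rank space of a core of [T' + T''] receives the corresponding rank
    spaces of the two given representations by coordinate inclusions [U_k] and
    [V_k], and every core of the sum has the form
    [U_k^T A_k U_(k+1) + V_k^T B_k V_(k+1)], where [A_k] and [B_k] are the given
    slices.  At an interior bond the two images are complementary, so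
    [U_k U_k^T = 1], [V_k V_k^T = 1], [U_k V_k^T = 0]: multiplying consecutive
    cores, the cross terms vanish and the chain telescopes to
    [U_0^T (A_1 ... A_d) U_d + V_0^T (B_1 ... B_d) V_d] ([chain_glue]).
    At the closing bond the two images overlap, but no product is
    taken there: by cyclicity of the trace and [U_0 U_0^T = 1], each
    summand contributes the trace of its own chain ([mxtrace_glue]), so only
    the size of the closing bond matters, not the relative position of the
    images.

    Both cases are instances of one construction, in which the closing
    bond has any size [p] that is at least [r'_0] and [r''_0] and both
    representations are padded to [p] ([TR_add_padded]); taking for [p] the
    larger of the two ranks makes one of the paddings trivial. *)

(** * Coordinate inclusions *)

(** The coordinate inclusion of [R^m] into [R^p] (on row vectors) at offset
    [s].  Entrywise comparison of natural numbers makes it meaningful for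
    all sizes, so sizes that are equal only propositionally need no casts. *)
Definition shift_mx (R : realType) (s m p : nat) : 'M[R]_(m, p) :=
  \matrix_(i, j) (s + i == j)%N%:R.

Lemma shift_mx_gram (R : realType) (s m p : nat) :
  (s + m <= p)%N -> shift_mx R s m p *m (shift_mx R s m p)^T = 1%:M.
Proof.
move=> le_p; apply/matrixP=> i j; rewrite !mxE.
have lt_i : (s + i < p)%N by apply: leq_trans le_p; rewrite ltn_add2l.
rewrite (bigD1 (Ordinal lt_i)) //= big1 ?addr0 => [|k ne_k].
  by rewrite !mxE eqxx mul1r eqn_add2l eq_sym.
rewrite !mxE; case: eqP => [eq_k|_]; last by rewrite mul0r.
by case/eqP: ne_k; apply: val_inj.
Qed.

Lemma shift_mx_orthogonal (R : realType) (s m m' p : nat) :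
  (m <= s)%N -> shift_mx R 0 m p *m (shift_mx R s m' p)^T = 0.
Proof.
move=> le_s; apply/matrixP=> i j; rewrite !mxE big1 // => k _; rewrite !mxE.
case: eqP => [<-|_]; last by rewrite mul0r.
rewrite add0n mul1r gtn_eqF //.
exact: leq_trans (ltn_ord i) (leq_trans le_s (leq_addr _ _)).
Qed.

Lemma shift_mx_left (R : realType) (m n : nat) :
  shift_mx R 0 m (m + n) = row_mx 1%:M 0.
Proof.
apply/matrixP=> i j; rewrite -(splitK j); case: (split j) => k /=.
  by rewrite row_mxEl !mxE.
by rewrite row_mxEr !mxE add0n ltn_eqF // ltn_addr.
Qed.

Lemma shift_mx_right (R : realType) (m n : nat) :
  shift_mx R m n (m + n) = row_mx 0 1%:M.
Proof.
apply/matrixP=> i j; rewrite -(splitK j); case: (split j) => k /=.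
  by rewrite row_mxEl !mxE gtn_eqF //= ltn_addr.
by rewrite row_mxEr !mxE eqn_add2l.
Qed.

Lemma pad_rowsE (R : realType) (m p q : nat) (le_mp : (m <= p)%N)
    (A : 'M[R]_(m, q)) :
  pad_rows le_mp A = (shift_mx R 0 m p)^T *m A.
Proof.
rewrite /pad_rows; move: (subnKC le_mp); move: (p - m)%N => x e.
case: p / e {le_mp}; rewrite castmx_id shift_mx_left.
by rewrite tr_row_mx mul_col_mx trmx1 trmx0 mul1mx mul0mx.
Qed.

Lemma pad_colsE (R : realType) (m p q : nat) (le_mp : (m <= p)%N)
    (A : 'M[R]_(q, m)) :
  pad_cols le_mp A = A *m shift_mx R 0 m p.
Proof.
rewrite /pad_cols; move: (subnKC le_mp); move: (p - m)%N => x e.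
case: p / e {le_mp}; rewrite castmx_id shift_mx_left.
by rewrite mul_mx_row mulmx1 mulmx0.
Qed.

Lemma shift_mx_id (R : realType) (m : nat) : shift_mx R 0 m m = 1%:M.
Proof. by apply/matrixP=> i j; rewrite !mxE. Qed.

Lemma pad_rows_id (R : realType) (m q : nat) (A : 'M[R]_(m, q)) :
  pad_rows (leqnn m) A = A.
Proof. by rewrite pad_rowsE shift_mx_id trmx1 mul1mx. Qed.

Lemma pad_cols_id (R : realType) (m q : nat) (A : 'M[R]_(q, m)) :
  pad_cols (leqnn m) A = A.
Proof. by rewrite pad_colsE shift_mx_id mulmx1. Qed.

(** * Glued cores *)

(** The direct sum of [A] and [B], carried to the size [p x q] with [A] at the
    origin and [B] at offset [(s, t)].  The two blocks may overlap, in which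
    case they are added. *)
Definition glue_mx (R : realType) (p q s t m m' n n' : nat)
    (A : 'M[R]_(m, n)) (B : 'M[R]_(m', n')) : 'M[R]_(p, q) :=
  (shift_mx R 0 m p)^T *m A *m shift_mx R 0 n q
  + (shift_mx R s m' p)^T *m B *m shift_mx R t n' q.

Lemma glue_mx_block (R : realType) (m m' n n' : nat)
    (A : 'M[R]_(m, n)) (B : 'M[R]_(m', n')) :
  glue_mx (m + m') (n + n') m n A B = block_mx A 0 0 B.
Proof.
rewrite /glue_mx !shift_mx_left !shift_mx_right !tr_row_mx !trmx1 !trmx0.
rewrite !mul_col_mx !mul1mx !mul0mx !mul_mx_row !mulmx0 !mulmx1.
by rewrite add_col_mx addr0 add0r.
Qed.

Lemma glue_mx_row (R : realType) (p m m' n n' : nat)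
    (le_mp : (m <= p)%N) (le_m'p : (m' <= p)%N)
    (A : 'M[R]_(m, n)) (B : 'M[R]_(m', n')) :
  glue_mx p (n + n') 0 n A B = row_mx (pad_rows le_mp A) (pad_rows le_m'p B).
Proof.
rewrite /glue_mx !pad_rowsE shift_mx_left shift_mx_right !mul_mx_row.
by rewrite !mulmx1 !mulmx0 add_row_mx addr0 add0r.
Qed.

Lemma glue_mx_col (R : realType) (q m m' n n' : nat)
    (le_nq : (n <= q)%N) (le_n'q : (n' <= q)%N)
    (A : 'M[R]_(m, n)) (B : 'M[R]_(m', n')) :
  glue_mx (m + m') q m 0 A B = col_mx (pad_cols le_nq A) (pad_cols le_n'q B).
Proof.
rewrite /glue_mx !pad_colsE shift_mx_left shift_mx_right !tr_row_mx.
rewrite !mul_col_mx trmx1 !trmx0 !mul1mx !mul0mx.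
by rewrite add_col_mx trmx1 mul1mx addr0 add0r.
Qed.

(** [glue_mx] makes sense at every size and offset, so substituting the equal
    sizes inside it turns the casts of [core_eq] into identities. *)
Lemma core_eq_glue (R : realType) (N p p' q q' s s' t t' m m' n n' : nat)
    (A : core R m N n) (B : core R m' N n') (H : core R p' N q') :
    p = p' -> q = q' -> s = s' -> t = t' ->
    (forall i, glue_mx p' q' s' t' (A i) (B i) = H i) ->
  core_eq (fun i => glue_mx p q s t (A i) (B i)) H.
Proof.
move=> ep eq -> -> eqH; case: p' / ep H eqH => H; case: q' / eq H => H eqH.
by exists (erefl, erefl) => i; rewrite castmx_id.
Qed.

Lemma eq_core_eq (R : realType) (N p p' q q' : nat) (G : core R p N q)
    (H K : core R p' N q') :
  H =1 K -> core_eq G H -> core_eq G K.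
Proof. by move=> eqHK [e eqG]; exists e => i; rewrite eqG eqHK. Qed.

(** Cyclicity of the trace removes the two inclusions of each chain at the
    closing bond, since they become adjacent and compose to the identity.  This
    happens in each summand separately, so overlapping blocks do no harm. *)
Lemma mxtrace_glue (R : realType) (m m' n n' p p' : nat) (em : m' = m)
    (en : n' = n) (ep : p' = p) (X : 'M[R]_(m, m')) (Y : 'M[R]_(n, n')) :
    (m <= p)%N -> (n <= p)%N ->
  \tr (castmx (erefl p, ep) (glue_mx p p' 0 0 X Y))
  = \tr (castmx (erefl m, em) X) + \tr (castmx (erefl n, en) Y).
Proof.
case: m / em X => X; case: n / en Y => Y; case: p / ep => le_mp le_np.
rewrite !castmx_id /glue_mx raddfD /=; congr (_ + _).
  by rewrite mxtrace_mulC mulmxA shift_mx_gram // mul1mx.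
by rewrite mxtrace_mulC mulmxA shift_mx_gram // mul1mx.
Qed.

(** Telescoping: multiplying by the next core meets [U_m U_m^T = 1] and
    [V_m V_m^T = 1] on the diagonal and [U_m V_m^T = 0] in the cross terms.
    Only the interior bonds are multiplied across, hence the range of [k]. *)
Lemma chain_glue (R : realType) (d : nat) (r r' r'' s : nat -> nat)
    (A : forall k : 'I_d, 'M[R]_(r' k, r' k.+1))
    (B : forall k : 'I_d, 'M[R]_(r'' k, r'' k.+1)) :
    (forall k, (0 < k < d)%N -> (r' k <= s k)%N /\ (s k + r'' k <= r k)%N) ->
  forall (m : nat) (le_md : (m <= d)%N), (0 < m)%N ->
  chain_mx (fun k : 'I_d => glue_mx (r k) (r k.+1) (s k) (s k.+1) (A k) (B k))
    le_md
  = glue_mx (r 0) (r m) (s 0) (s m) (chain_mx A le_md) (chain_mx B le_md).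
Proof.
move=> rs; elim=> // m IHm lt_md _ /=.
have [m0|m_gt0] := posnP m.
  by subst m; rewrite /= !mul1mx.
have [le_s le_r] : (r' m <= s m)%N /\ (s m + r'' m <= r m)%N.
  by apply: rs; rewrite m_gt0.
rewrite IHm // /glue_mx /= mulmxDl !mulmxDr.
move: (chain_mx A _) (chain_mx B _) (A _) (B _) => X Y /= A1 B1.
have UU := @shift_mx_gram R 0 (r' m) (r m)
  (leq_trans le_s (leq_trans (leq_addr _ _) le_r)).
have VV := @shift_mx_gram R (s m) (r'' m) (r m) le_r.
have UV := @shift_mx_orthogonal R (s m) (r' m) (r'' m) (r m) le_s.
have VU : shift_mx R (s m) (r'' m) (r m) *m (shift_mx R 0 (r' m) (r m))^T = 0.
  by rewrite -[LHS]trmxK trmx_mul trmxK UV trmx0.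
rewrite !mulmxA -!(mulmxA _ (shift_mx R _ _ _) (shift_mx R _ _ _)^T).
by rewrite UU VV UV VU !mulmx1 !mulmx0 !mul0mx addr0 add0r.
Qed.

(** * Sums of TR-representations *)

(** The equation [q = p] in the descriptions of the end cores leaves free how
    the size of the closing bond is written, as [r' 0], [r' k] or [r' k.+1]. *)
Lemma TR_add_padded (R : realType) (d : nat) (hd : (2 <= d)%N)
  (n : 'I_d -> nat) (r' r'' : nat -> nat)
  (er' : r' d = r' 0%N) (er'' : r'' d = r'' 0%N)
  (G' : cores R n r') (G'' : cores R n r'') (T' T'' : tensor R n)
  (hT' : TR_representation er' G' T')
  (hT'' : TR_representation er'' G'' T'')
  (p : nat) (le_r'p : (r' 0 <= p)%N) (le_r''p : (r'' 0 <= p)%N) :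
  exists (r : nat -> nat) (er : r d = r 0%N) (G : cores R n r),
    [/\ forall k : 'I_d, (0 < k)%N -> (k.+1 < d)%N ->
          core_eq (G k) (fun i => block_mx (G' k i) 0 0 (G'' k i)),
        forall k : 'I_d, k = 0%N :> nat -> forall q : nat, q = p ->
          forall (l' : (r' k <= q)%N) (l'' : (r'' k <= q)%N),
          core_eq (G k) (fun i =>
            row_mx (pad_rows l' (G' k i)) (pad_rows l'' (G'' k i))),
        forall k : 'I_d, k.+1 = d -> forall q : nat, q = p ->
          forall (l' : (r' k.+1 <= q)%N) (l'' : (r'' k.+1 <= q)%N),
          core_eq (G k) (fun i =>
            col_mx (pad_cols l' (G' k i)) (pad_cols l'' (G'' k i)))
      & TR_representation er G (T' + T'')].
Proof.
pose r k := if (0 < k < d)%N then (r' k + r'' k)%N else p.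
(* At the closing bond both blocks start at the origin. *)
pose s k := if (0 < k < d)%N then r' k else 0%N.
have r_in k : (0 < k < d)%N -> r k = (r' k + r'' k)%N by rewrite /r => ->.
have s_in k : (0 < k < d)%N -> s k = r' k by rewrite /s => ->.
have r_d : r d = p by rewrite /r ltnn andbF.
have s_d : s d = 0%N by rewrite /s ltnn andbF.
have er : r d = r 0%N by rewrite r_d.
pose G : cores R n r :=
  fun k i => glue_mx (r k) (r k.+1) (s k) (s k.+1) (G' k i) (G'' k i).
exists r, er, G; split.
- move=> k k_gt0 lt_k1d; have lt_kd := ltnW lt_k1d.
  apply: core_eq_glue; rewrite ?r_in ?s_in ?k_gt0 //.
  by move=> i; apply: glue_mx_block.
- move=> k k0 q eq_qp l' l''.
  have k1_in : (0 < k.+1 < d)%N by rewrite k0.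
  apply: (@core_eq_glue _ _ _ _ _ _ _ 0%N _ (r' k.+1)).
  + by rewrite k0 eq_qp.
  + exact: r_in.
  + by rewrite k0.
  + exact: s_in.
  + by move=> i; apply: glue_mx_row.
- move=> k k1d q eq_qp l' l''.
  have k_in : (0 < k < d)%N by rewrite ltn_ord andbT -ltnS k1d.
  apply: (@core_eq_glue _ _ _ _ _ _ _ (r' k) _ 0%N).
  + exact: r_in.
  + by rewrite k1d eq_qp.
  + exact: s_in.
  + by rewrite k1d.
  + by move=> i; apply: glue_mx_col.
- move=> i; rewrite ffunE hT' hT'' chain_glue; first last.
  + exact: ltnW.
  + by move=> k k_in; rewrite r_in ?s_in.
  by rewrite s_d (mxtrace_glue er' er'').
Qed.

Theorem theorem3p3 (R : realType) (d : nat) (hd : (2 <= d)%N)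
  (n : 'I_d -> nat) (r' r'' : nat -> nat)
  (er' : r' d = r' 0%N) (er'' : r'' d = r'' 0%N)
  (G' : cores R n r') (G'' : cores R n r'')
  (T' T'' : tensor R n)
  (hT' : TR_representation er' G' T')
  (hT'' : TR_representation er'' G'' T'') :
  (forall h : (r'' 0 <= r' 0)%N,
     exists (r : nat -> nat) (er : r d = r 0%N) (G : cores R n r),
       [/\ forall k : 'I_d, (0 < k)%N -> (k.+1 < d)%N ->
             core_eq (G k) (fun i => block_mx (G' k i) 0 0 (G'' k i)),
           forall (k : 'I_d) (hk : k = 0%N :> nat),
             core_eq (G k) (fun i =>
               row_mx (G' k i) (pad_rows (first_rank_le h hk) (G'' k i))),
           forall (k : 'I_d) (hk : k.+1 = d),
             core_eq (G k) (fun i =>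
               col_mx (G' k i)
                      (pad_cols (last_rank_le er'' er' h hk) (G'' k i)))
         & TR_representation er G (T' + T'')])
  /\
  (forall h : (r' 0 <= r'' 0)%N,
     exists (r : nat -> nat) (er : r d = r 0%N) (G : cores R n r),
       [/\ forall k : 'I_d, (0 < k)%N -> (k.+1 < d)%N ->
             core_eq (G k) (fun i => block_mx (G' k i) 0 0 (G'' k i)),
           forall (k : 'I_d) (hk : k = 0%N :> nat),
             core_eq (G k) (fun i =>
               row_mx (pad_rows (first_rank_le h hk) (G' k i)) (G'' k i)),
           forall (k : 'I_d) (hk : k.+1 = d),
             core_eq (G k) (fun i =>
               col_mx (pad_cols (last_rank_le er' er'' h hk) (G' k i))
                      (G'' k i))
         & TR_representation er G (T' + T'')]).
Proof.
split=> h.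
  have [r [er [G [mid first last rep]]]] :=
    TR_add_padded hd hT' hT'' (leqnn _) h.
  exists r, er, G; split=> // k hk.
    have e : r' k = r' 0%N by rewrite hk.
    apply: eq_core_eq (first k hk _ e (leqnn _) (first_rank_le h hk)).
    by move=> i; rewrite pad_rows_id.
  have e : r' k.+1 = r' 0%N by rewrite hk.
  apply: eq_core_eq (last k hk _ e (leqnn _) (last_rank_le er'' er' h hk)).
  by move=> i; rewrite pad_cols_id.
have [r [er [G [mid first last rep]]]] :=
  TR_add_padded hd hT' hT'' h (leqnn _).
exists r, er, G; split=> // k hk.
  have e : r'' k = r'' 0%N by rewrite hk.
  apply: eq_core_eq (first k hk _ e (first_rank_le h hk) (leqnn _)).
  by move=> i; rewrite pad_rows_id.
have e : r'' k.+1 = r'' 0%N by rewrite hk.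
apply: eq_core_eq (last k hk _ e (last_rank_le er' er'' h hk) (leqnn _)).
by move=> i; rewrite pad_cols_id.
Qed.
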